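(* Let $H$ be an $n$-vertex $3$-graph with $n\ge 7$ and $\delta_2(H)\ge 3$. Then for every vertex $u$ of $H$ there is a copy of $S_3$ in $H$ with center $u$, i.e. six distinct vertices $a_1,\dots,a_6$ different from $u$ such that $\{u,a_1,a_2\},\{u,a_3,a_4\},\{u,a_5,a_6\}$ are edges of $H$.
   Context: $\delta_2(H)$ is the minimum over pairs of vertices of the number of edges containing the pair. $S_3$ is the $3$-graph with edges $\{v_0,v_1,v_2\},\{v_0,v_3,v_4\},\{v_0,v_5,v_6\}$ on seven distinct vertices, with center $v_0$. *)

(* Defs.v *)
From mathcomp Require Import all_boot.

Set Implicit Arguments.
Unset Strict Implicit.
Unset Printing Implicit Defensive.

Record three_graph (V : finType) := ThreeGraph {
  edges : {set {set V}};
  card_edge : forall e, e \in edges -> #|e| = 3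
}.

Definition codegree (V : finType) (H : three_graph V) (p : {set V}) : nat :=
  #|[set e in edges H | p \subset e]|.

(* The default value #|edges H| bounds every codegree, so it does not affect
   the minimum as soon as V has a pair of distinct vertices. *)
Definition min_codegree (V : finType) (H : three_graph V) : nat :=
  \big[minn/#|edges H|]_(p : {set V} | #|p| == 2) codegree H p.

(* Edge set of S_3 with center v0, on vertices v0, ..., v6; users must
   require these vertices to be distinct. *)
Definition S3 (V : finType) (v0 v1 v2 v3 v4 v5 v6 : V) : {set {set V}} :=
  [set [set v0; v1; v2]; [set v0; v3; v4]; [set v0; v5; v6]].

(* Main.v *)
Require Import Defs.
From mathcomp Require Import all_boot.

(** In the link graph of [u] every vertex other than [u] has degree at least 3,
    and a copy of S_3 centered at [u] is a matching of size 3 in this graph.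
    Take a matching {ab, cd} and two uncovered vertices x, y.  If x or y has an
    uncovered neighbour, the matching extends.  Otherwise x and y send at least
    six edges to {a, b, c, d}, hence at least three to one of the two matching
    edges, say ab, and then x-a-b-y or x-b-a-y is an augmenting path. *)

Lemma bigminn_leq (I : eqType) (r : seq I) (P : pred I) (F : I -> nat)
    (x : nat) (j : I) :
  j \in r -> P j -> \big[minn/x]_(i <- r | P i) F i <= F j.
Proof.
move=> + Pj; elim: r => [//|i r IHr].
rewrite inE big_cons => /orP[/eqP <-|/IHr le_r]; first by rewrite Pj geq_minl.
by case: ifP => // _; rewrite geq_min le_r orbT.
Qed.

Lemma min_codegree_leq (V : finType) (H : three_graph V) (p : {set V}) :
  #|p| = 2 -> min_codegree H <= codegree H p.
Proof.
by move=> /eqP p2; apply: bigminn_leq => //; rewrite mem_index_enum.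
Qed.

Section Matching.

Variables (T : finType) (e : rel T).

(** If all neighbours of [x] lie in [s], filtering [s] by [e x] lists each of them at least once.
    Degree bounds thus yield either a neighbour outside a partial matching or many neighbours inside
    it. *)
Lemma neighbor_notin_or_count (x : T) (s : seq T) :
  (exists2 z, z \notin s & e x z) \/ #|[set w | e x w]| <= count (e x) s.
Proof.
have [/exists_inP[z]|/exists_inPn noz] := boolP [exists z in [predC s], e x z].
  by left; exists z.
right; rewrite -size_filter; apply: leq_trans (card_size _).
apply/subset_leq_card/subsetP => w; rewrite inE mem_filter => exw.
rewrite exw /=; apply: contraLR exw => ws; exact: noz.
Qed.

Lemma exists_notin (W : {set T}) (s : seq T) :
  size s < #|W| -> exists2 x, x \in W & x \notin s.
Proof.
move=> lt_s; have /subsetPn[x xW xs] : ~~ (W \subset s).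
  apply: contraL lt_s => /subset_leq_card le_W.
  by rewrite -leqNgt (leq_trans le_W) // card_size.
by exists x.
Qed.

(** The degree bound is confined to [W] because the lemma is applied to a link graph, where the
    center [u] is isolated. Only [a], [c], [x], [y] are picked from [W]; their partners arise as
    neighbours. *)
Lemma exists_matching3 (W : {set T}) :
  symmetric e -> irreflexive e -> 6 <= #|W| ->
  (forall v, v \in W -> 3 <= #|[set w | e v w]|) ->
  exists a1 a2 a3 a4 a5 a6 : T,
    uniq [:: a1; a2; a3; a4; a5; a6] /\ [/\ e a1 a2, e a3 a4 & e a5 a6].
Proof.
move=> esym eirr W6 deg3.
have neq_e v w : e v w -> v != w by apply: contraTneq => ->; rewrite eirr.
have [a aW _] : exists2 a, a \in W & a \notin [::].
  by apply: exists_notin; apply: leq_trans W6.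
have [b eab] : exists b, e a b.
  case: (neighbor_notin_or_count a [::]) => [[b _ eab]|]; first by exists b.
  by move/(leq_trans (deg3 a aW)).
have [c cW cNab] : exists2 c, c \in W & c \notin [:: a; b].
  by apply: exists_notin; apply: leq_trans W6.
(* At most two of the three or more neighbours of [c] lie in [[:: a; b]]. *)
have [d dNab ecd] : exists2 d, d \notin [:: a; b] & e c d.
  case: (neighbor_notin_or_count c [:: a; b]) => // le_c.
  by have := leq_trans (deg3 c cW) (leq_trans le_c (count_size _ _)).
have Uabcd : uniq [:: a; b; c; d].
  move: cNab dNab (neq_e _ _ eab) (neq_e _ _ ecd).
  rewrite /= !inE !negb_or => /andP[ca cb] /andP[da db] ab cd.
  by rewrite ab cd ![a == _]eq_sym ![b == c]eq_sym ![b == d]eq_sym ca cb da db.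
have augment x : x \in W -> x \notin [:: a; b; c; d] ->
    (exists a1 a2 a3 a4 a5 a6 : T,
      uniq [:: a1; a2; a3; a4; a5; a6] /\ [/\ e a1 a2, e a3 a4 & e a5 a6]) \/
    3 <= count (e x) [:: a; b; c; d].
  move=> xW xN; case: (neighbor_notin_or_count x [:: a; b; c; d]); last first.
    by move/(leq_trans (deg3 x xW)); right.
  case=> z zN exz; left; exists x, z, a, b, c, d; split=> //.
  rewrite cons_uniq inE negb_or neq_e // xN /=.
  by rewrite zN.
have [x xW xN] : exists2 x, x \in W & x \notin [:: a; b; c; d].
  by apply: exists_notin; apply: leq_trans W6.
(* Five vertices are excluded here, which uses the full bound [6 <= #|W|]. *)
have [y yW] : exists2 y, y \in W & y \notin [:: x; a; b; c; d].
  by apply: exists_notin.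
rewrite inE negb_or => /andP[yx yN].
case: (augment x xW xN) => // cx; case: (augment y yW yN) => // cy.
have Uxy : uniq [:: x; y; a; b; c; d].
  by rewrite cons_uniq inE negb_or eq_sym yx xN cons_uniq yN.
have reorder s : perm_eq [:: x; y; a; b; c; d] s -> uniq s.
  by move/perm_uniq <-.
(* The eight possible edges from [x] and [y] to the matching split into these four pairs. At least
   six are present, so some pair is complete; the truth values are checked exhaustively. *)
have : [|| e x a && e y b, e x b && e y a, e x c && e y d | e x d && e y c].
  move: cx cy; rewrite /=.
  by case: (e x a); case: (e x b); case: (e x c); case: (e x d);
     case: (e y a); case: (e y b); case: (e y c); case: (e y d).
(* Here [pq] is the matching edge exchanged for [xp] and [yq], while [rs] is kept. *)
have Uabxy p q r s : perm_eq [:: a; b; c; d] [:: p; q; r; s] ->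
    uniq [:: x; p; y; q; r; s].
  move=> eq_s; apply: reorder; rewrite perm_cons.
  apply: (@perm_trans _ [:: y; p; q; r; s]); first by rewrite perm_cons.
  by rewrite -[y :: _]/([:: y] ++ [:: p] ++ [:: q; r; s]) perm_catCA.
have perm4 (p q r s : T) : perm_eq [:: p; q; r; s] [:: q; p; r; s].
  by rewrite -[_ :: _]/([:: p] ++ [:: q] ++ [:: r; s]) perm_catCA.
have permCA (p q r s : T) : perm_eq [:: p; q; r; s] [:: r; s; p; q].
  by rewrite -[_ :: _]/([:: p; q] ++ [:: r; s]) perm_catC.
case/or4P => /andP[ex ey].
- by exists x, a, y, b, c, d; split=> //; apply: Uabxy.
- by exists x, b, y, a, c, d; split=> //; apply: Uabxy.
- by exists x, c, y, d, a, b; split=> //; apply: Uabxy.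
- exists x, d, y, c, a, b; split=> //; apply: Uabxy.
  exact: perm_trans (permCA _ _ _ _) (perm4 _ _ _ _).
Qed.

End Matching.

(** The relation is defined on all of [V]; since edges have three elements, [u] is isolated in it
    and there are no loops. *)
Definition link (V : finType) (H : three_graph V) (u : V) : rel V :=
  fun v w => [set u; v; w] \in edges H.
Arguments link {V} H u.

Section Link.

Variables (V : finType) (H : three_graph V) (u : V).

Lemma link_sym : symmetric (link H u).
Proof. by move=> v w; rewrite /link setUAC. Qed.

Lemma link_irr : irreflexive (link H u).
Proof.
move=> v; apply/negP => /card_edge.
by rewrite -setUA setUid cards2; case: (u != v).
Qed.

Lemma link_neq v w : link H u v w -> u != v.
Proof.
apply: contraTneq => <-; apply/negP => /card_edge.
by rewrite setUid cards2; case: (u != w).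
Qed.

(** Every edge containing [u] and [v] is [[set u; v; w]] for its third vertex [w], so these edges
    lie in the image of the link neighbourhood of [v]. *)
Lemma codegree_leq_link v :
  u != v -> codegree H [set u; v] <= #|[set w | link H u v w]|.
Proof.
move=> uv; rewrite /codegree.
apply: leq_trans (leq_imset_card (fun w => [set u; v; w]) _).
apply/subset_leq_card/subsetP => E; rewrite inE => /andP[EH uvE].
have /cards1P[w Ew] : #|E :\: [set u; v]| == 1.
  by rewrite cardsD (setIidPr uvE) cards2 uv (card_edge EH).
have defE : E = [set u; v; w].
  by rewrite -(setID E [set u; v]) (setIidPr uvE) Ew.
by apply/imsetP; exists w => //; rewrite inE /link -defE.
Qed.

End Link.

Theorem theorem8 (n : nat) (V : finType) (H : three_graph V)
    (card_V : #|V| = n) (n_ge7 : 7 <= n)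
    (codeg_ge3 : 3 <= min_codegree H) (u : V) :
  exists a1 a2 a3 a4 a5 a6 : V,
    uniq [:: u; a1; a2; a3; a4; a5; a6] /\
    S3 u a1 a2 a3 a4 a5 a6 \subset edges H.
Proof.
(* The set [W] is taken to be all vertices except [u], of size [n - 1]. *)
have W6 : 6 <= #|[set~ u]| by rewrite cardsC1 card_V -ltnS (ltn_predK n_ge7).
have deg3 v : v \in [set~ u] -> 3 <= #|[set w | link H u v w]|.
  rewrite !inE eq_sym => uv.
  apply: leq_trans codeg_ge3 (leq_trans _ (codegree_leq_link V H u v uv)).
  by apply: min_codegree_leq; rewrite cards2 uv.
have [a1 [a2 [a3 [a4 [a5 [a6 [Ua [e12 e34 e56]]]]]]]] :=
  exists_matching3 V _ _ (link_sym V H u) (link_irr V H u) W6 deg3.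
exists a1, a2, a3, a4, a5, a6; split.
  rewrite cons_uniq Ua andbT !inE !negb_or.
  (* The matching avoids [u] because both ends of a link edge differ from [u], the second one by
     symmetry. *)
  have neq v w : link H u v w -> (u != v) && (u != w).
    by move=> uvw; rewrite (link_neq V H u v w) // (link_neq V H u w v) // link_sym.
  have [/andP[-> ->] /andP[-> ->]] := (neq _ _ e12, neq _ _ e34).
  by have /andP[-> ->] := neq _ _ e56.
by apply/subsetP => E; rewrite !inE -orbA => /or3P[] /eqP ->.
Qed.
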